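(* Let $G$ be a faithful weakly hyperbolic group that is not lim-free. Then the transitivity degree of $G$ is at most $3$.
   Context: A hyperbolic space is a geodesic metric space $S$ (not assumed proper) such that for some $\delta\ge 0$, $\langle x|y\rangle_o\ge\min\{\langle x|z\rangle_o,\langle z|y\rangle_o\}-\delta$ for all $x,y,z,o\in S$, where $\langle x|y\rangle_o=\frac12(d(x,o)+d(y,o)-d(x,y))$. Its Gromov boundary $\partial S$ is the set of equivalence classes of sequences $(x_i)$ in $S$ with $\langle x_i|x_j\rangle_o\to\infty$ as $i,j\to\infty$, where $(x_i)\sim(y_i)$ iff $\langle x_i|y_j\rangle_o\to\infty$; a sequence in the class $a$ is said to converge to $a$. For $a,b\in\partial S$, $\langle a|b\rangle_o$ is the infimum of $\liminf_{i,j}\langle x_i|y_j\rangle_o$ over sequences $x_i\to a$, $y_j\to b$; $\partial S$ is topologized so that the sets $\{b\in\partial S:\langle a|b\rangle_o>r\}$, $r\ge 0$, form a neighborhood base at $a$. All group actions on hyperbolic spaces are by isometries; they extend to actions by homeomorphisms on $\partial S$. The limit set $\Lambda_S(G)\subseteq\partial S$ of a group $G$ acting on $S$ is the set of points of $\partial S$ that are limits of sequences in an orbit $Gs$ (independent of $s\in S$), with the subspace topology. An element $g\in G$ is loxodromic if $\langle g\rangle$ has unbounded orbits in $S$ and fixes exactly two points of $\partial S$. The action of $G$ on $S$ is of general type if its orbits are unbounded and $G$ contains two loxodromic elements with disjoint fixed point sets in $\partial S$. An action by homeomorphisms on a topological space $X$ is topologically free if for every nontrivial element $g$ the set of fixed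 points of $g$ in $X$ has empty interior. A group is faithful weakly hyperbolic if it admits a general type action on a hyperbolic space such that the induced action on the limit set is faithful. It is lim-free if it admits a general type action on a hyperbolic space such that the induced action on the limit set is topologically free. An action of $G$ on a set $\Omega$ is $k$-transitive if for any two $k$-tuples of distinct points $(\omega_1,\dots,\omega_k)$, $(v_1,\dots,v_k)$ of $\Omega$ there is $g\in G$ with $g\omega_i=v_i$ for all $i$. The transitivity degree of $G$ is the maximum (or supremum, possibly $\infty$) of those $k\in\mathbb N$ such that $G$ admits a $k$-transitive faithful action on some set. *)

(* Defs.v *)
From HB Require Import structures.
From mathcomp Require Import all_boot all_order all_algebra.
From mathcomp Require Import all_classical all_reals all_analysis.

Set Implicit Arguments.
Unset Strict Implicit.
Unset Printing Implicit Defensive.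

Import Order.TTheory GRing.Theory Num.Theory.
Import numFieldNormedType.Exports.

Local Open Scope classical_set_scope.
Local Open Scope ring_scope.

Record gaction (G : groupType) (X : Type) := GAction {
  gact :> G -> X -> X ;
  gact1 : forall x, gact 1%g x = x ;
  gactM : forall g h x, gact (g * h)%g x = gact g (gact h x) }.

Section group_actions.
Context {G : groupType}.

Definition fixpts {X : Type} (a : gaction G X) (g : G) : set X :=
  [set x | a g x = x].

Definition faithful {X : Type} (a : gaction G X) :=
  forall g : G, (forall x, a g x = x) -> g = 1%g.

Definition topologically_free {X : topologicalType} (a : gaction G X) :=
  forall g : G, g <> 1%g -> interior (fixpts a g) = set0.

Definition ktransitive {X : Type} (k : nat) (a : gaction G X) :=
  forall w v : 'I_k -> X, injective w -> injective v ->
    exists g : G, forall i, a g (w i) = v i.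

Definition cyclic_subgroup (g : G) : set G :=
  [set h | exists n : nat, h = (g ^+ n)%g \/ h = (g ^- n)%g].

Lemma gactK {X : Type} (a : gaction G X) (g : G) : cancel (a g) (a g^-1%g).
Proof. by move=> x; rewrite -gactM mulVg gact1. Qed.

Lemma gactKV {X : Type} (a : gaction G X) (g : G) : cancel (a g^-1%g) (a g).
Proof. by move=> x; rewrite -gactM mulgV gact1. Qed.

End group_actions.

Section hyperbolic_spaces.
Context {R : realType} {S : metricType R}.

Definition gromov (x y o : S) : R :=
  2^-1 * (mdist x o + mdist y o - mdist x y).

Definition geodesic_space :=
  forall x y : S, exists c : R -> S,
    [/\ c 0 = x, c (mdist x y) = y &
        forall s t, 0 <= s <= mdist x y -> 0 <= t <= mdist x y ->
          mdist (c s) (c t) = `|s - t|].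

Definition hyperbolic :=
  geodesic_space /\
  exists2 delta : R, 0 <= delta & forall x y z o : S,
    Num.min (gromov x z o) (gromov z y o) - delta <= gromov x y o.

(* Changing o moves the Gromov product by at most the distance between the two
   base points, so the choice of o is immaterial; quantifying over all of them
   makes the notions below base-point free. *)
Definition gromov_cvgy (x y : nat -> S) :=
  forall o : S,
    gromov (x ij.1) (y ij.2) o @[ij --> (\oo, \oo)] --> +oo.

Definition boundary_class (x : nat -> S) : set (nat -> S) :=
  [set y | gromov_cvgy y y /\ gromov_cvgy x y].

End hyperbolic_spaces.
Arguments geodesic_space {R} S.
Arguments hyperbolic {R} S.

Record boundary (R : realType) (S : metricType R) := Boundary {
  bclass : set (nat -> S) ;
  _ : exists2 x : nat -> S, gromov_cvgy x x & bclass = boundary_class x }.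

Section boundary_topology.
Context {R : realType} {S : metricType R}.

Definition cvg_bdry (x : nat -> S) (a : boundary S) := bclass a x.

Definition bgromov (a b : boundary S) (o : S) : \bar R :=
  ereal_inf [set l | exists x y : nat -> S, [/\ cvg_bdry x a, cvg_bdry y b &
    l = limf_einf (fun ij : nat * nat => (gromov (x ij.1) (y ij.2) o)%:E)
                  (filter_prod \oo \oo)]].

Definition bnbhs (o : S) (a : boundary S) (r : R) : set (boundary S) :=
  [set b | (r%:E < bgromov a b o)%E].

(* When S is hyperbolic, this is the unique topology for which the sets
   bnbhs o a r, r >= 0, form a neighborhood base at a. *)
Definition bopen : set_system (boundary S) :=
  [set U | forall a, U a -> forall o, exists2 r, 0 <= r & bnbhs o a r `<=` U].

Lemma boundary_inj (a b : boundary S) : bclass a = bclass b -> a = b.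
Proof.
case: a b => [A HA] [B HB] /= AB; subst B.
by rewrite (Prop_irrelevance HA HB).
Qed.

Lemma bopenT : bopen setT.
Proof. by move=> a _ o; exists 0. Qed.

Lemma bopenI : setI_closed bopen.
Proof.
move=> A B oA oB a [Aa Ba] o.
have [r r0 rA] := oA a Aa o; have [s s0 sB] := oB a Ba o.
exists (Num.max r s); first by rewrite le_max r0.
move=> b bab; split; [apply: rA|apply: sB]; apply: le_lt_trans bab;
  by rewrite lee_fin le_max lexx ?orbT.
Qed.

Lemma bopen_bigU (I : Type) (f : I -> set (boundary S)) :
  (forall i, bopen (f i)) -> bopen (\bigcup_i f i).
Proof.
move=> of_ a [i _ fia] o; have [r r0 rf] := of_ i a fia o.
by exists r => // b /rf fib; exists i.
Qed.

HB.instance Definition _ := gen_eqMixin (boundary S).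
HB.instance Definition _ := gen_choiceMixin (boundary S).
HB.instance Definition _ :=
  isOpenTopological.Build (boundary S) bopenT bopenI bopen_bigU.

End boundary_topology.

Record isoaction (R : realType) (G : groupType) (S : metricType R) :=
  IsoAction {
    iso_gact :> gaction G S ;
    iso_mdist : forall g x y, mdist (iso_gact g x) (iso_gact g y) = mdist x y }.

Section induced_actions.
Context {R : realType} {G : groupType} {S : metricType R}.
Variable a : isoaction G S.

Lemma gromov_act g x y o : gromov (a g x) (a g y) (a g o) = gromov x y o.
Proof. by rewrite /gromov !iso_mdist. Qed.

Lemma gromov_cvgy_act g (x y : nat -> S) :
  gromov_cvgy x y -> gromov_cvgy (a g \o x) (a g \o y).
Proof.
move=> xy o; rewrite -(gactKV a g o).
under eq_fun do rewrite gromov_act.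
exact: xy.
Qed.

Lemma bact_subproof g (p : boundary S) :
  exists2 x : nat -> S, gromov_cvgy x x &
    [set a g \o y | y in bclass p] = boundary_class x.
Proof.
case: p => A [x xx Ax] /=; rewrite {}Ax; exists (a g \o x); first exact: gromov_cvgy_act.
apply/seteqP; split => [_ [y [yy xy] <-]|z [zz xz]].
  by split; exact: gromov_cvgy_act.
exists (a g^-1%g \o z); last by apply/funext => n /=; rewrite gactKV.
split; first exact: gromov_cvgy_act.
suff -> : x = a g^-1%g \o (a g \o x) by exact: gromov_cvgy_act.
by apply/funext => n /=; rewrite gactK.
Qed.

Definition bact g (p : boundary S) : boundary S := Boundary (bact_subproof g p).

Lemma bact1 p : bact 1%g p = p.
Proof.
apply: boundary_inj => /=; apply/seteqP; split => [_ [y py <-]|y py].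
  by rewrite (_ : _ \o _ = y)//; apply/funext => n /=; rewrite gact1.
by exists y => //; apply/funext => n /=; rewrite gact1.
Qed.

Lemma bactM g h p : bact (g * h)%g p = bact g (bact h p).
Proof.
apply: boundary_inj => /=; rewrite image_comp; congr image.
by apply/funext => y; apply/funext => n /=; rewrite gactM.
Qed.

Definition boundary_action : gaction G (boundary S) := GAction bact1 bactM.

Definition limit_set : set (boundary S) :=
  [set p | exists (s : S) (g : nat -> G), cvg_bdry (fun n => a (g n) s) p].

Lemma limit_set_act g p : limit_set p -> limit_set (boundary_action g p).
Proof.
move=> [s [h hp]]; exists s, (fun n => (g * h n)%g).
exists (fun n => a (h n) s) => //.
by apply/funext => n /=; rewrite gactM.
Qed.

Definition lact g (p : limit_set) : limit_set :=
  SigSub (mem_set (limit_set_act g (set_valP p))).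

Lemma lact1 p : lact 1%g p = p.
Proof. by apply: val_inj; rewrite /= bact1. Qed.

Lemma lactM g h p : lact (g * h)%g p = lact g (lact h p).
Proof. by apply: val_inj; rewrite /= bactM. Qed.

(* The type limit_set carries the subspace topology from boundary S. *)
Definition limit_action : gaction G limit_set := GAction lact1 lactM.

Definition unbounded_orbits (H : set G) :=
  forall s : S, ~ exists M : R,
    forall g h, H g -> H h -> mdist (a g s) (a h s) <= M.

Definition loxodromic (g : G) :=
  unbounded_orbits (cyclic_subgroup g) /\
  exists p q : boundary S, p <> q /\
    \bigcap_(h in cyclic_subgroup g) fixpts boundary_action h = [set p; q].

Definition general_type :=
  unbounded_orbits setT /\
  exists g h : G, [/\ loxodromic g, loxodromic h &
    fixpts boundary_action g `&` fixpts boundary_action h = set0].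

End induced_actions.

Definition faithful_weakly_hyperbolic (R : realType) (G : groupType) :=
  exists (S : metricType R) (a : isoaction G S),
    [/\ hyperbolic S, general_type a & faithful (limit_action a)].

Definition lim_free (R : realType) (G : groupType) :=
  exists (S : metricType R) (a : isoaction G S),
    [/\ hyperbolic S, general_type a & topologically_free (limit_action a)].

Definition transitivity_degree (R : realType) (G : groupType) : \bar R :=
  ereal_sup [set k%:R%:E | k in [set k : nat |
    exists (X : Type) (a : gaction G X), faithful a /\ ktransitive k a]].

(* Main.v *)
(* Let f <> 1 fix pointwise a nonempty open subset of the limit set L. If h_n o
   converges to a point of that subset, then h_n^-1 f h_n moves only points of L
   seen from o almost exactly in the direction of h_n^-1 o. Translating by the
   elements of a finite set built from two loxodromics, f gets conjugates
   supported in arbitrarily deep shadows in three directions whose pairwise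
   Gromov products are bounded independently of the depth. Elements of G with
   disjoint supports in L commute, the action on L being faithful.

   Let G act faithfully and 4-transitively on an infinite set X, and call g small
   if it fixes pointwise a nonempty open subset of L.

   Suppose that no nontrivial small element fixes a point of X. Take conjugates
   f1, f2 of f with disjoint supports and h fixing x, f1 x, f2 x but not f1 f2 x.
   One of the commutators [h, f1], [h, f2] is small; it fixes a point of X, so it
   is trivial, and then h fixes f1 f2 x = f2 f1 x, a contradiction.

   Otherwise we may assume that f fixes some point of X and moves another one.
   Take conjugates f1, f2 supported in separated shadows and w1, w2 in X such that
   each fi fixes exactly one of w1, w2. Let l, l' be conjugates of f supported
   in very deep shadows of y, y', moving v, v' in X. By 4-transitivity some g
   maps (w1, w2) to (v, l v) while g k maps it to (v', l' v'), with k in a fixed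
   finite set. Then g fi g^-1 and l do not commute, so g moves points of the
   supports of f1 and f2 into the support of l, which forces g o to lie deep in
   the direction of y. Likewise g k o lies deep in the direction of y'. As g o and
   g k o are at bounded distance, y and y' have a large Gromov product, a
   contradiction. *)

Require Import Defs.
From HB Require Import structures.
From mathcomp Require Import all_boot all_order all_algebra.
From mathcomp Require Import all_classical all_reals all_analysis.
From mathcomp Require Import lra.

Set Implicit Arguments.
Unset Strict Implicit.
Unset Printing Implicit Defensive.

Import Order.TTheory GRing.Theory Num.Theory.
Import numFieldNormedType.Exports.

Local Open Scope classical_set_scope.
Local Open Scope ring_scope.

(** * Gromov products of points and of sequences of points *)

Section gromov_product.
Context {R : realType} {S : metricType R}.
Implicit Types (x y z o : S) (u v w : nat -> S).

Lemma gromovC x y o : gromov x y o = gromov y x o.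
Proof. by rewrite /gromov (metric_sym x y) (addrC (mdist x o)). Qed.

Lemma gromov_ge0 x y o : 0 <= gromov x y o.
Proof.
rewrite /gromov; have := metric_triangle x o y; rewrite (metric_sym o y); lra.
Qed.

Lemma gromov_xx x o : gromov x x o = mdist x o.
Proof. by rewrite /gromov mdistxx; lra. Qed.

Lemma gromov_le_mdist x y o : gromov x y o <= mdist x o.
Proof.
rewrite /gromov; have := metric_triangle y x o; rewrite (metric_sym y x); lra.
Qed.

Lemma gromov_le_move x x' y y' o :
  gromov x y o - mdist x x' - mdist y y' <= gromov x' y' o.
Proof.
rewrite /gromov.
have := metric_triangle x x' o; have := metric_triangle y y' o.
have := metric_triangle x' x y'; have := metric_triangle x y y'.
rewrite (metric_sym x' x); lra.
Qed.

Lemma gromov_le_base x y o o' : gromov x y o - mdist o o' <= gromov x y o'.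
Proof.
rewrite /gromov.
have := metric_triangle x o' o; have := metric_triangle y o' o.
rewrite (metric_sym o' o); lra.
Qed.

Lemma gromov_base_sum x y o : gromov x o y + gromov x y o = mdist o y.
Proof.
by rewrite /gromov (metric_sym o y); lra.
Qed.

Lemma mdist_sub_le_gromov x y o : mdist x o - mdist x y <= gromov x y o.
Proof.
rewrite /gromov; have := metric_triangle x y o; lra.
Qed.

(* A point [x] close to a geodesic from [p] to [q] is seen from [o] at least as
   far in the direction of [p] as [q] is. *)
Lemma gromov_between p q x o :
  gromov p q o - gromov p q x <= gromov x p o.
Proof.
rewrite /gromov.
have := metric_triangle q x o; rewrite (metric_sym x p); lra.
Qed.

Lemma gromov_between_sum p q x o :
  mdist x o + gromov p q o - gromov p q x = gromov x p o + gromov x q o.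
Proof. rewrite /gromov (metric_sym x p) (metric_sym x q); lra. Qed.

(* Constant sequences are allowed: [prod_ge o u (fun=> y) r] bounds the product
   of a boundary point represented by [u] and the point [y]. *)
Definition prod_ge o u v (r : R) := exists N : nat,
  forall i j, (N <= i)%N -> (N <= j)%N -> r <= gromov (u i) (v j) o.

Lemma prod_geC o u v r : prod_ge o u v r -> prod_ge o v u r.
Proof. by move=> [N uv]; exists N => i j Ni Nj; rewrite gromovC; exact: uv. Qed.

Lemma prod_ge_le o u v r s : s <= r -> prod_ge o u v r -> prod_ge o u v s.
Proof.
by move=> sr [N uv]; exists N => i j Ni Nj; apply: le_trans sr _; exact: uv.
Qed.

(** Changing the base point costs at most [mdist o o'], so one base point suffices. *)
Lemma gromov_cvgyP o u v :
  gromov_cvgy u v <-> forall r, prod_ge o u v r.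
Proof.
split=> [+ r|uv o'].
  move=> /(_ o) /cvgryPge /(_ r) [[P Q] /= [[N _ NP] [M _ MQ]] PQ].
  exists (maxn N M) => i j; rewrite !geq_max => /andP[Ni Mi] /andP[Nj Mj].
  by apply: (PQ (i, j)); split; [exact: NP|exact: MQ].
apply/cvgryPge => r; have [N uvN] := uv (r + mdist o o').
exists ([set i | (N <= i)%N], [set i | (N <= i)%N]).
  by split; exists N.
move=> [i j] [/= Ni Nj]; have := gromov_le_base (u i) (v j) o o'.
have := uvN _ _ Ni Nj; lra.
Qed.

End gromov_product.

(** * Boundary points and shadows, seen from one fixed base point *)

Section four_point.
Context {R : realType} {S : metricType R} (o : S) (d : R).
Hypothesis hyp : forall x y z : S,
  Num.min (gromov x z o) (gromov z y o) - d <= gromov x y o.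
Implicit Types (x y z : S) (u v w : nat -> S) (p q : boundary S).

Lemma four_point_ge0 : 0 <= d.
Proof. by have := hyp o o o; rewrite /gromov !mdistxx minxx; lra. Qed.

Lemma gromov_trans r x z y :
  r <= gromov x z o -> r <= gromov z y o -> r - d <= gromov x y o.
Proof.
move=> xz zy; apply: le_trans (hyp x y z).
by rewrite lerD2r le_min xz.
Qed.

Lemma prod_ge_trans r u v w :
  prod_ge o u v r -> prod_ge o v w r -> prod_ge o u w (r - d).
Proof.
move=> [N uv] [M vw]; exists (maxn N M) => i j.
rewrite !geq_max => /andP[Ni Mi] /andP[Nj Mj].
by apply: (@gromov_trans _ _ (v (maxn N M))); [apply: uv|apply: vw];
  rewrite ?leq_maxl ?leq_maxr.
Qed.

Lemma gromov_cvgy_trans u v w :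
  gromov_cvgy u v -> gromov_cvgy v w -> gromov_cvgy u w.
Proof.
move=> /(gromov_cvgyP o) uv /(gromov_cvgyP o) vw.
apply/(gromov_cvgyP o) => r; rewrite -(addrK d r).
exact: prod_ge_trans (uv _) (vw _).
Qed.

Lemma gromov_cvgy_sym u v : gromov_cvgy u v -> gromov_cvgy v u.
Proof.
move=> /(gromov_cvgyP o) uv; apply/(gromov_cvgyP o) => r.
exact: prod_geC.
Qed.

Lemma bclass_cvgy p u v : bclass p u -> bclass p v -> gromov_cvgy u v.
Proof.
case: p => A [x xx Ax] /=; rewrite {}Ax => -[_ xu] [_ xv].
exact: gromov_cvgy_trans (gromov_cvgy_sym xu) xv.
Qed.

Lemma bclass_closed p u v :
  bclass p u -> gromov_cvgy u v -> bclass p v.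
Proof.
case: p => A [x xx Ax] /=; rewrite {}Ax => -[_ xu] uv; split.
  exact: gromov_cvgy_trans (gromov_cvgy_sym uv) uv.
exact: gromov_cvgy_trans xu uv.
Qed.

Lemma bclass_prod_ge p u v r : bclass p u -> bclass p v -> prod_ge o u v r.
Proof.
by move=> pu pv; move: r; apply/gromov_cvgyP; exact: bclass_cvgy pu pv.
Qed.

Lemma bclass_nonempty p : exists u, bclass p u.
Proof. by case: p => A [x xx Ax] /=; exists x; rewrite {}Ax. Qed.

Lemma boundary_eq p q u v :
  bclass p u -> bclass q v -> gromov_cvgy u v -> p = q.
Proof.
move=> pu qv uv; apply: boundary_inj; apply/seteqP; split=> w.
  move=> pw; apply: bclass_closed qv _.
  exact: gromov_cvgy_trans (gromov_cvgy_sym uv) (bclass_cvgy pu pw).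
move=> qw; apply: bclass_closed pu _.
exact: gromov_cvgy_trans uv (bclass_cvgy qv qw).
Qed.

Lemma boundary_neq p q u v :
  p <> q -> bclass p u -> bclass q v -> exists c, ~ prod_ge o u v c.
Proof.
move=> pq pu qv; apply/existsNP => uv; apply: pq.
by apply: boundary_eq pu qv _; apply/(gromov_cvgyP o).
Qed.

(** One choice of representatives is enough: by [near_prod_ge], any other choice loses at most
    [2 * d]. *)
Definition near_bdry p q r :=
  exists u v, [/\ bclass p u, bclass q v & prod_ge o u v r].

Definition shadow y r p := exists2 u, bclass p u & prod_ge o u (fun=> y) r.

Lemma near_bdryC p q r : near_bdry p q r -> near_bdry q p r.
Proof.
by move=> [u [v [pu qv uv]]]; exists v, u; split => //; exact: prod_geC.
Qed.

Lemma near_bdry_le p q r s : s <= r -> near_bdry p q r -> near_bdry p q s.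
Proof.
by move=> sr [u [v [pu qv uv]]]; exists u, v; split => //; exact: prod_ge_le uv.
Qed.

Lemma near_prod_ge p q r u v : near_bdry p q r -> bclass p u -> bclass q v ->
  prod_ge o u v (r - d - d).
Proof.
move=> [u' [v' [pu' qv' uv']]] pu qv.
apply: (@prod_ge_trans _ _ v'); last exact: bclass_prod_ge qv' qv.
by apply: (@prod_ge_trans _ _ u') => //; exact: bclass_prod_ge pu pu'.
Qed.

Lemma shadow_prod_ge p y r u : shadow y r p -> bclass p u ->
  prod_ge o u (fun=> y) (r - d).
Proof.
move=> [v pv vy] pu.
by apply: (@prod_ge_trans _ _ v) => //; exact: bclass_prod_ge pu pv.
Qed.

Lemma near_bdry_trans p q p' r : near_bdry p q r -> near_bdry q p' r ->
  near_bdry p p' (r - d - d).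
Proof.
move=> [u [v [pu qv uv]]] [v' [w [qv' p'w vw]]]; exists u, w; split => //.
apply: (@prod_ge_trans _ _ v'); last first.
  by apply: prod_ge_le vw; have := four_point_ge0; lra.
by apply: (@prod_ge_trans _ _ v) => //; exact: bclass_prod_ge qv qv'.
Qed.

Lemma near_shadow p q y r : near_bdry p q r -> shadow y r q ->
  shadow y (r - d - d) p.
Proof.
move=> [u [v [pu qv uv]]] qy; exists u => //.
apply: (@prod_ge_trans _ _ v); last exact: shadow_prod_ge qy qv.
by apply: prod_ge_le uv; have := four_point_ge0; lra.
Qed.

Lemma near_bnbhs p q r s : r < s - d - d -> near_bdry p q s -> bnbhs o p r q.
Proof.
move=> rs pq; rewrite /bnbhs /=; apply: (@lt_le_trans _ _ (s - d - d)%:E).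
  by rewrite lte_fin.
apply: le_ereal_inf_tmp => _ [u [v [pu qv ->]]].
have [N uvN] := near_prod_ge pq pu qv.
rewrite limf_einfE; apply: ereal_sup_ge.
exists (ereal_inf [set (gromov (u ij.1) (v ij.2) o)%:E | ij in
  [set ij : nat * nat | (N <= ij.1)%N /\ (N <= ij.2)%N]]).
  exists [set ij : nat * nat | (N <= ij.1)%N /\ (N <= ij.2)%N] => //.
  exists ([set i | (N <= i)%N], [set i | (N <= i)%N]); first by split; exists N.
  by move=> [i j].
apply: le_ereal_inf_tmp => _ [[i j] [/= Ni Nj] <-].
by rewrite lee_fin; exact: uvN.
Qed.

(** A sequence going to [p] would link [y] to [y'] by the four-point inequality, against the bound
    [E]. *)
Lemma shadow_disjoint y y' r E p : gromov y y' o <= E -> E + d + d < r ->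
  shadow y r p -> shadow y' r p -> False.
Proof.
move=> yyE Er [u pu uy] py'; have d0 := four_point_ge0.
have uy' := shadow_prod_ge py' pu.
have rd : r - d <= r by lra.
have [N /(_ N N (leqnn _) (leqnn _))] :=
  prod_ge_trans (prod_geC (prod_ge_le rd uy)) uy'; lra.
Qed.

End four_point.

(** * Dynamics of the group on the boundary and on the limit set *)

Section boundary_dynamics.
Context {R : realType} {G : groupType} {S : metricType R} (a : isoaction G S).
Context (o : S) (d : R).
Hypothesis hyp : forall x y z : S,
  Num.min (gromov x z o) (gromov z y o) - d <= gromov x y o.
Implicit Types (x y z : S) (u v w : nat -> S) (p q : boundary S) (f g h t : G).

Lemma mdist_actV g : mdist (a g^-1%g o) o = mdist (a g o) o.
Proof. by rewrite -(iso_mdist a g) gactKV metric_sym. Qed.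

Lemma bclass_act g p u : bclass p u -> bclass (bact a g p) (a g \o u).
Proof. by move=> pu; exists u. Qed.

Lemma bactK g p : bact a g^-1%g (bact a g p) = p.
Proof. exact: (gactK (boundary_action a)). Qed.

Lemma bactKV g p : bact a g (bact a g^-1%g p) = p.
Proof. exact: (gactKV (boundary_action a)). Qed.

Lemma bact_inj g : injective (bact a g).
Proof. exact: can_inj (bactK g). Qed.

Lemma bact_fixV g p : bact a g p = p -> bact a g^-1%g p = p.
Proof. by move=> {1}<-; rewrite bactK. Qed.

Lemma conj_moved g f p : bact a (g * f * g^-1)%g p <> p ->
  bact a f (bact a g^-1%g p) <> bact a g^-1%g p.
Proof. by move=> + fp; apply; rewrite !bactM fp bactKV. Qed.

Lemma limit_set_orbit p : limit_set a p ->
  exists h : nat -> G, bclass p (fun n => a (h n) o).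
Proof.
move=> [s [h ph]]; exists h; apply: (bclass_closed hyp ph).
apply/(gromov_cvgyP o) => r.
have [N hN] := bclass_prod_ge hyp (r + mdist s o) ph ph.
exists N => i j Ni Nj.
have := gromov_le_move (a (h i) s) (a (h i) s) (a (h j) s) (a (h j) o) o.
have := hN i j Ni Nj; rewrite mdistxx iso_mdist; lra.
Qed.

(** Metric form of fixing pointwise a neighborhood of some point of the limit set. *)
Definition small g := exists p r, limit_set a p /\
  forall q, limit_set a q -> near_bdry o p q r -> bact a g q = q.

Definition supp_in g y r :=
  forall p, limit_set a p -> bact a g p <> p -> shadow o y r p.

Lemma supp_in_le g y r s : s <= r -> supp_in g y r -> supp_in g y s.
Proof.
move=> sr gy p lp /(gy p lp)[u pu uy]; exists u => //; exact: prod_ge_le uy.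
Qed.

Lemma supp_in_conj g f y r : supp_in f y r ->
  supp_in (g * f * g^-1)%g (a g y) (r - mdist (a g o) o).
Proof.
move=> fy p lp /conj_moved fp.
have [u pu [N uy]] := fy _ (limit_set_act _ lp) fp.
exists (a g \o u); first by have := bclass_act g pu; rewrite bactKV.
exists N => i j Ni Nj /=.
have := gromov_le_base (a g (u i)) (a g y) (a g o) o.
rewrite gromov_act; have := uy i j Ni Nj; lra.
Qed.

(* If [k_n o] converges to [p] and [q] stays away from [p], then [k_n^-1] sends
   [q] into the direction of [k_n^-1 o]. *)
Lemma small_conj_supp f : small f ->
  exists C, forall D, exists h, D <= mdist (a h o) o /\
    supp_in (h * f * h^-1)%g (a h o) (mdist (a h o) o - C).
Proof.
move=> [p [r [lp fp]]]; have [k pk] := limit_set_orbit lp.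
have d0 := four_point_ge0 hyp.
exists (r + d + d) => D.
have [N kN] := bclass_prod_ge hyp (Num.max (r + d) D) pk pk.
have kND i j : (N <= i)%N -> (N <= j)%N ->
    r + d <= gromov (a (k i) o) (a (k j) o) o /\
    D <= gromov (a (k i) o) (a (k j) o) o.
  by move=> Ni Nj; have := kN i j Ni Nj; rewrite ge_max => /andP.
exists (k N)^-1%g; rewrite mdist_actV; split.
  have [_ /le_trans] := kND N N (leqnn _) (leqnn _); apply.
  exact: gromov_le_mdist.
move=> q lq /conj_moved; rewrite invgK => fq.
have [v qv] := bclass_nonempty q; exists v => //.
set L := mdist _ _.
have [M vM] := bclass_prod_ge hyp (L - (r + d + d) + d) qv qv.
exists M => i _ Mi _; rewrite leNgt; apply/negP => lti; apply: fq.
apply: fp; first exact: limit_set_act.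
exists (fun n => a (k n) o), (a (k N) \o v).
split => //; first exact: bclass_act.
exists (maxn N M) => m j; rewrite !geq_max => /andP[Nm Mm] /andP[Nj Mj].
rewrite -(addrK d r); apply: (gromov_trans hyp (z := a (k N) o)).
  by have [] := kND m N Nm (leqnn _).
have vj : gromov (v j) (a (k N)^-1%g o) o < L - (r + d + d) + d.
  rewrite ltNge; apply/negP => jge; move: lti; rewrite ltNge => /negP; apply.
  rewrite -(addrK d (L - (r + d + d))).
  by apply: (gromov_trans hyp (z := v j)) => //; exact: vM.
(* The products of [v j] with [k_N^-1 o] from [o] and with [o] from [k_N^-1 o] add up to [L]. The
   first is small, so the second is large, and [k_N] carries it to the base point [o]. *)
have -> : gromov (a (k N) o) ((a (k N) \o v) j) o =
          gromov (v j) o (a (k N)^-1%g o).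
  by rewrite gromovC -(gromov_act a (k N) (v j)) gactKV.
have := gromov_base_sum (v j) (a (k N)^-1%g o) o.
rewrite (metric_sym o) mdist_actV -/L; lra.
Qed.

(* [t] fixes [p] and [q], so [t o] is as close as [o] to a geodesic from [p] to
   [q]; hence it lies in the direction of one of the two. *)
Lemma fix_pair_shadow p q : p <> q ->
  exists c, 0 <= c /\ forall t, bact a t p = p -> bact a t q = q ->
    shadow o (a t o) (mdist (a t o) o - c) p \/
    shadow o (a t o) (mdist (a t o) o - c) q.
Proof.
move=> pq; have d0 := four_point_ge0 hyp.
have [u pu] := bclass_nonempty p; have [v qv] := bclass_nonempty q.
have [c0 uv0] := boundary_neq hyp pq pu qv.
pose c := Num.max c0 0.
have uvc : ~ prod_ge o u v c.
  by move=> uv; apply: uv0; apply: prod_ge_le uv; rewrite le_max lexx.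
have c0ge : 0 <= c by rewrite le_max lexx orbT.
(* In [sumX] the product seen from [t o] costs [c + 2 * d] and the smaller term on the right
   [c + d]; passing to the tail of [u] or [v] costs the last [d]. *)
exists (c + c + d + d + d + d); split; first by lra.
move=> t tp tq.
have ptu : bclass p (a t^-1%g \o u).
  by rewrite -(bact_fixV tp); exact: bclass_act.
have qtv : bclass q (a t^-1%g \o v).
  by rewrite -(bact_fixV tq); exact: bclass_act.
set X := a t o; set D := mdist X o.
have [N1 uu] := bclass_prod_ge hyp D pu pu.
have [N2 vv] := bclass_prod_ge hyp D qv qv.
have [N3 tu] := bclass_prod_ge hyp (c + d + d) pu ptu.
have [N4 tv] := bclass_prod_ge hyp (c + d + d) qtv qv.
pose N := maxn (maxn N1 N2) (maxn N3 N4).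
have {uvc} [i [j [Ni Nj ltc]]] :
    exists i j, [/\ (N <= i)%N, (N <= j)%N & gromov (u i) (v j) o < c].
  apply: contrapT => nex; apply: uvc; exists N => i j Ni Nj.
  by rewrite leNgt; apply/negP => lt; apply: nex; exists i, j.
move: Ni Nj; rewrite !geq_max => /andP[/andP[N1i N2i] /andP[N3i N4i]].
move=> /andP[/andP[N1j N2j] /andP[N3j N4j]].
have uvX : gromov (u i) (v j) X < c + d + d.
  rewrite ltNge; apply/negP => ge; move: ltc; rewrite ltNge => /negP; apply.
  rewrite -[leLHS](addrK d); apply: (gromov_trans hyp (z := a t^-1%g (v j))).
    rewrite -[leLHS](addrK d); apply: (gromov_trans hyp (z := a t^-1%g (u i))).
      exact: tu.
    by move: ge; rewrite -(gromov_act a t^-1%g) /X gactK.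
  by have := tv j j N4j N4j => /=; lra.
have sumX := gromov_between_sum (u i) (v j) X o.
have uv_ge0 := gromov_ge0 (u i) (v j) o.
have [Xu|Xu] := lerP (c + d) (gromov X (u i) o); last first.
  right; exists v => //; exists N2 => k _ N2k _.
  have -> : D - (c + c + d + d + d + d) =
    D - (c + c + d + d + d) - d by lra.
  apply: (gromov_trans hyp (z := v j)).
    by have := vv _ _ N2k N2j; lra.
  rewrite gromovC; move: sumX; rewrite -/D; lra.
have Xv : gromov X (v j) o < c + d.
  rewrite ltNge; apply/negP => ge; move: ltc; rewrite ltNge => /negP; apply.
  rewrite -[leLHS](addrK d); apply: (gromov_trans hyp (z := X)) => //.
  by rewrite gromovC.
left; exists u => //; exists N1 => k _ N1k _.
have -> : D - (c + c + d + d + d + d) =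
  D - (c + c + d + d + d) - d by lra.
apply: (gromov_trans hyp (z := u i)).
  by have := uu _ _ N1k N1i; lra.
rewrite gromovC; move: sumX; rewrite -/D; lra.
Qed.

(** By [gromov_base_sum], the products from [o] of [x] with [t^-1 o] and of [t x] with [t o] add up
    to [mdist (a t o) o], so they cannot both be nearly that large. *)
Lemma shadow_actV t p c : bact a t p = p ->
  2 * c + d < mdist (a t o) o ->
  shadow o (a t o) (mdist (a t o) o - c) p ->
  ~ shadow o (a t^-1%g o) (mdist (a t o) o - c) p.
Proof.
move=> tp Dc tsh [u pu [N uN]].
have ptu : bclass p (a t \o u) by rewrite -tp; exact: bclass_act.
have [M tM] := shadow_prod_ge hyp tsh ptu.
have := tM (maxn N M) (maxn N M) (leq_maxr _ _) (leq_maxr _ _).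
have := uN (maxn N M) (maxn N M) (leq_maxl _ _) (leq_maxl _ _).
rewrite -(gromov_act a t) gactKV /=.
have := gromov_base_sum (a t (u (maxn N M))) (a t o) o.
rewrite (metric_sym o); lra.
Qed.

(** Elements [t] of the cyclic group move [o] arbitrarily far, and [t o], [t^-1 o] then point
    towards different fixed points. *)
Lemma loxodromic_shadows g : loxodromic a g ->
  exists p q, [/\ p <> q, bact a g p = p, bact a g q = q &
    forall M, exists t, shadow o (a t o) M p /\ shadow o (a t^-1%g o) M q].
Proof.
move=> [unb [p [q [pq fixpq]]]].
have fixp h : cyclic_subgroup g h -> bact a h p = p /\ bact a h q = q.
  move=> gh; split.
    have : [set p; q] p by left.
    by rewrite -fixpq => /(_ h gh).
  have : [set p; q] q by right.
  by rewrite -fixpq => /(_ h gh).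
have [gp gq] : bact a g p = p /\ bact a g q = q.
  by apply: fixp; exists 1%N; left; rewrite expg1.
exists p, q; split=> // M; have [c [c0 sh]] := fix_pair_shadow pq.
have [t [tp tq Dt]] : exists t, [/\ bact a t p = p, bact a t q = q &
    Num.max (2 * c + d) (M + c) < mdist (a t o) o].
  apply: contrapT => nex; apply: (unb o).
  exists (Num.max (2 * c + d) (M + c)) => h k /fixp[hp hq] /fixp[kp kq].
  rewrite leNgt; apply/negP => lt; apply: nex; exists (h^-1 * k)%g.
  rewrite !bactM kp kq; split; [exact: bact_fixV|exact: bact_fixV|].
  by rewrite -(iso_mdist a h) gactM gactKV metric_sym.
move: Dt; rewrite gt_max => /andP[Dt Mt].
have shM y r : shadow o y (mdist (a t o) o - c) r -> shadow o y M r.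
  by move=> [u ru uy]; exists u => //; apply: prod_ge_le uy; lra.
have := sh _ (bact_fixV tp) (bact_fixV tq); rewrite mdist_actV => shV.
have [tosh|tosh] := sh t tp tq; [exists t|exists t^-1%g; rewrite invgK].
  by split; apply: shM => //; case: shV => // /(shadow_actV tp Dt tosh).
by split; apply: shM => //; case: shV => // /(shadow_actV tq Dt tosh).
Qed.

(** North-south dynamics: if [y] does not point towards [t^-1 o], then [t y] points towards [t o],
    hence towards [p]. *)
Lemma shadow_push t p q M K y : shadow o (a t o) M p ->
  shadow o (a t^-1%g o) M q -> 2 * K + 2 * d <= M -> 0 <= K ->
  ~ shadow o y K q -> shadow o (a t y) K p.
Proof.
move=> [u pu [N uN]] [v qv [N' vN]] KM K0 nyq; have d0 := four_point_ge0 hyp.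
have ylt : gromov y (a t^-1%g o) o < K + d.
  rewrite ltNge; apply/negP => ge; apply: nyq; exists v => //.
  exists N' => i j Ni Nj; rewrite -(addrK d K).
  apply: (gromov_trans hyp (z := a t^-1%g o)); last by rewrite gromovC.
  by have := vN i i Ni Ni; lra.
have Mt : M <= mdist (a t^-1%g o) o.
  apply: le_trans (vN N' N' (leqnn _) (leqnn _)) _.
  by rewrite gromovC; exact: gromov_le_mdist.
exists u => //; exists N => i j Ni Nj; rewrite -(addrK d K).
apply: (gromov_trans hyp (z := a t o)); first by have := uN i j Ni Nj; lra.
have := gromov_base_sum y (a t^-1%g o) o.
rewrite -(gromov_act a t y) gactKV gromovC (metric_sym o); lra.
Qed.

Lemma bdry_separated p q : p <> q ->
  exists c, forall K, c <= K -> forall y z,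
    shadow o y K p -> shadow o z K q -> gromov y z o < K.
Proof.
move=> pq; have d0 := four_point_ge0 hyp.
have [u pu] := bclass_nonempty p; have [v qv] := bclass_nonempty q.
have [c uvc] := boundary_neq hyp pq pu qv.
exists (c + d + d + d + d) => K cK y z yp zq.
rewrite ltNge; apply/negP => yz; apply: uvc.
have yz' : prod_ge o (fun=> y) (fun=> z) (K - d).
  by exists 0%N => *; lra.
have uz := prod_ge_trans hyp (shadow_prod_ge hyp yp pu) yz'.
have Kd : K - d - d <= K - d by lra.
have := prod_ge_trans hyp uz
  (prod_geC (prod_ge_le Kd (shadow_prod_ge hyp zq qv))).
by apply: prod_ge_le; lra.
Qed.

Lemma shadow_mdist y K p : shadow o y K p -> K <= mdist y o.
Proof.
move=> [u pu [N uN]]; apply: le_trans (uN N N (leqnn _) (leqnn _)) _.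
by rewrite gromovC; exact: gromov_le_mdist.
Qed.

(** Ping-pong: [y] points towards at most one of the four fixed points of two loxodromics, so at
    least three of [t], [t^-1], [s], [s^-1] push it towards their own attracting points. *)
Lemma general_type_spread : general_type a ->
  exists E B, forall y, exists g1 g2 g3,
    [/\ gromov (a g1 y) (a g2 y) o <= E, gromov (a g1 y) (a g3 y) o <= E &
        gromov (a g2 y) (a g3 y) o <= E] /\
    [/\ mdist (a g1 o) o <= B, mdist (a g2 o) o <= B & mdist (a g3 o) o <= B].
Proof.
move=> [_ [g [h [/loxodromic_shadows[p1 [p2 [p12 gp1 gp2 sh1]]]]]]].
move=> /loxodromic_shadows[p3 [p4 [p34 hp3 hp4 sh3]]] ghfix.
have neq p q : bact a g p = p -> bact a h q = q -> p <> q.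
  move=> gp hq pq; move: (ghfix) => /seteqP[/(_ p) + _]; apply; split => //=.
  by rewrite pq.
have [c12 s12] := bdry_separated p12; have [c34 s34] := bdry_separated p34.
have [c13 s13] := bdry_separated (neq _ _ gp1 hp3).
have [c14 s14] := bdry_separated (neq _ _ gp1 hp4).
have [c23 s23] := bdry_separated (neq _ _ gp2 hp3).
have [c24 s24] := bdry_separated (neq _ _ gp2 hp4).
pose E := Num.max (Num.max c12 (Num.max c34 c13))
  (Num.max (Num.max c14 c23) (Num.max c24 0)).
have : E <= E by []; rewrite {1}/E !ge_max.
move=> /andP[/andP[e12 /andP[e34 e13]] /andP[/andP[e14 e23] /andP[e24 E0]]].
clearbody E; move: (s12 _ e12) (s34 _ e34) (s13 _ e13).
move: (s14 _ e14) (s23 _ e23) (s24 _ e24).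
move=> {}s14 {}s23 {}s24 {}s12 {}s34 {}s13.
have excl p q y : (forall y z, shadow o y E p -> shadow o z E q ->
    gromov y z o < E) -> shadow o y E p -> ~ shadow o y E q.
  by move=> s yp yq; have := s _ _ yp yq; have := shadow_mdist yp;
     rewrite gromov_xx; lra.
have [t [t1 t2]] := sh1 (2 * E + 2 * d); have [s [s3 s4]] := sh3 (2 * E + 2 * d).
have push1 y : ~ shadow o y E p2 -> shadow o (a t y) E p1.
  by apply: shadow_push t1 t2 _ E0.
have push2 y : ~ shadow o y E p1 -> shadow o (a t^-1%g y) E p2.
  by apply: (@shadow_push _ _ _ _ _ _ t2) (E0); rewrite ?invgK //; exact: t1.
have push3 y : ~ shadow o y E p4 -> shadow o (a s y) E p3.
  by apply: shadow_push s3 s4 _ E0.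
have push4 y : ~ shadow o y E p3 -> shadow o (a s^-1%g y) E p4.
  by apply: (@shadow_push _ _ _ _ _ _ s4) (E0); rewrite ?invgK //; exact: s3.
exists E, (Num.max (mdist (a t o) o) (mdist (a s o) o)) => y.
have [y1|y1] := pselect (shadow o y E p1).
  have y2 := excl _ _ _ s12 y1; have y3 := excl _ _ _ s13 y1.
  have y4 := excl _ _ _ s14 y1.
  exists t, s, s^-1%g; rewrite !le_max !mdist_actV !lexx !orbT; split => //.
  by split; apply/ltW; [apply: s13|apply: s14|apply: s34]; auto.
have [y2|y2] := pselect (shadow o y E p2).
  have y3 := excl _ _ _ s23 y2; have y4 := excl _ _ _ s24 y2.
  exists t^-1%g, s, s^-1%g; rewrite !le_max !mdist_actV !lexx !orbT; split => //.
  by split; apply/ltW; [apply: s23|apply: s24|apply: s34]; auto.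
have [y3|y3] := pselect (shadow o y E p3).
  have y4 := excl _ _ _ s34 y3.
  exists t, t^-1%g, s; rewrite !le_max !mdist_actV !lexx !orbT; split => //.
  by split; apply/ltW; [apply: s12|apply: s13|apply: s23]; auto.
exists t, t^-1%g, s^-1%g; rewrite !le_max !mdist_actV !lexx !orbT; split => //.
by split; apply/ltW; [apply: s12|apply: s14|apply: s24]; auto.
Qed.

Lemma small_conj_spread : general_type a -> exists E, forall f r, small f ->
  exists t1 t2 t3 y1 y2 y3,
    [/\ gromov y1 y2 o <= E, gromov y1 y3 o <= E & gromov y2 y3 o <= E] /\
    [/\ supp_in (t1 * f * t1^-1)%g y1 r, supp_in (t2 * f * t2^-1)%g y2 r &
        supp_in (t3 * f * t3^-1)%g y3 r].
Proof.
move=> /general_type_spread[E [B spread]]; exists E => f r.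
(* [C] is lost in [small_conj_supp], and at most [B] in conjugating by a spreading element. *)
move=> /small_conj_supp[C /(_ (r + C + B))[h [hD hf]]].
have [g1 [g2 [g3 [gE [B1 B2 B3]]]]] := spread (a h o).
exists (g1 * h)%g, (g2 * h)%g, (g3 * h)%g.
exists (a g1 (a h o)), (a g2 (a h o)), (a g3 (a h o)); split => //.
have conjM g : ((g * h) * f * (g * h)^-1 = g * (h * f * h^-1) * g^-1)%g.
  by rewrite invgM !mulgA.
rewrite !conjM.
by split; apply: (supp_in_le _ (supp_in_conj hf)); lra.
Qed.

(* [g] moves a point of each of two separated shadows into the shadow of [y];
   as [o] is close to a geodesic joining these two, [g o] is seen towards [y]. *)
Lemma gromov_of_two_points g y y1 y2 (r r0 : R) E p q :
  gromov y1 y2 o <= E -> E + 2 * d < r0 ->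
  shadow o y1 r0 p -> shadow o y2 r0 q ->
  shadow o y r (bact a g p) -> shadow o y r (bact a g q) ->
  r - E - 5 * d <= gromov (a g o) y o.
Proof.
move=> yE Er [u pu [N1 uN]] [v qv [N2 vN]] zp zq; have d0 := four_point_ge0 hyp.
have [N3 zuN] := shadow_prod_ge hyp zp (bclass_act g pu).
have [N4 zvN] := shadow_prod_ge hyp zq (bclass_act g qv).
pose N := maxn (maxn N1 N2) (maxn N3 N4).
have : (N <= N)%N by []; rewrite {1}/N !geq_max.
move=> /andP[/andP[l1 l2] /andP[l3 l4]].
move: (uN _ _ l1 l1) (vN _ _ l2 l2) (zuN _ _ l3 l3) (zvN _ _ l4 l4) => /=.
set P := u N; set Q := v N => Py1 Qy2 zPy zQy.
have PQ : gromov P Q o <= E + 2 * d.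
  rewrite leNgt; apply/negP => lt.
  (* Capped at [r0], the bound holds along the whole chain [y1], [P], [Q], [y2]. *)
  pose m := Num.min (gromov P Q o) r0.
  have mP : m <= gromov P Q o by rewrite ge_min lexx.
  have mr : m <= r0 by rewrite ge_min lexx orbT.
  have mE : E + 2 * d < m by rewrite lt_min lt.
  have y1P : m <= gromov y1 P o by rewrite gromovC; lra.
  have Qy : m - d <= gromov Q y2 o by lra.
  have := gromov_trans hyp (gromov_trans hyp y1P mP) Qy; lra.
have zPQ : r - 2 * d <= gromov (a g P) (a g Q) o.
  have := gromov_trans hyp (r := r - d) zPy (z := y) (y := a g Q).
  by rewrite (gromovC y) => /(_ zQy); lra.
have := gromov_between (a g P) (a g Q) (a g o) o; rewrite gromov_act => zoP.
have E0 := le_trans (gromov_ge0 y1 y2 o) yE.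
have gPy : r - E - 4 * d <= gromov (a g P) y o by lra.
have := gromov_trans hyp (r := r - E - 4 * d) (x := a g o) _ gPy; lra.
Qed.

Lemma faithful_bact g h : faithful (limit_action a) ->
  (forall p, limit_set a p -> bact a g p = bact a h p) -> g = h.
Proof.
move=> fa gh; apply: divg1_eq; apply: fa => p; apply: val_inj => /=.
rewrite bactM gh ?bactKV //; exact: limit_set_act (set_valP p).
Qed.

(** If [g] fixes [p], then either [g] fixes [h p], or [h] fixes [h p] and hence [p]; both ways
    [g h p = h g p]. *)
Lemma disjoint_supp_commute g h : faithful (limit_action a) ->
  (forall p, limit_set a p -> bact a g p = p \/ bact a h p = p) ->
  (g * h = h * g)%g.
Proof.
move=> fa gh; apply: faithful_bact => // p lp; rewrite !bactM.
wlog gp : g h gh / bact a g p = p => [H|].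
  have [gp|hp] := gh p lp; first exact: H.
  by apply/esym/H => // q /gh[]; [right|left].
by rewrite gp; have [|/bact_inj /= ->] := gh _ (limit_set_act h lp).
Qed.

Lemma not_topologically_free_small : ~ topologically_free (limit_action a) ->
  exists2 f : G, f <> 1%g & small f.
Proof.
move=> /existsNP[f] /not_implyP[f1 /eqP/set0P[p fp]]; exists f => //.
move: fp; rewrite /interior /= nbhsE => -[B [[A oA <-] /= Ap] AB].
have d0 := four_point_ge0 hyp.
have [r r0 rA] := oA _ Ap o.
(* The margin pays for the change of representatives and the strict inequality in [bnbhs]. *)
exists (val p), (r + 2 * d + 1); split; first exact: set_valP.
move=> q lq pq; have /rA Aq : bnbhs o (val p) r q.
  by apply: (near_bnbhs hyp _ pq); lra.
by have := AB (SigSub (mem_set lq)) Aq => /(congr1 val).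
Qed.

End boundary_dynamics.

(** * Multiply transitive actions on infinite sets *)

Section transitivity.
Context {G : groupType} {X : choiceType} (b : gaction G X).

Lemma uniq_extend (m : nat) (s : seq X) :
  (forall s : seq X, exists x, x \notin s) -> uniq s ->
  exists2 t, uniq (s ++ t) & size t = m.
Proof.
move=> infX us; elim: m => [|m [t ust tm]]; first by exists [::]; rewrite ?cats0.
have [x xst] := infX (s ++ t).
exists (rcons t x); last by rewrite size_rcons tm.
by rewrite -rcons_cat rcons_uniq xst.
Qed.

(** Shorter tuples are padded with fresh points up to length [k]. *)
Lemma ktransitive_seq (k : nat) (s t : seq X) :
  (forall s : seq X, exists x, x \notin s) -> ktransitive k b ->
  uniq s -> uniq t -> size s = size t -> (size s <= k)%N ->
  exists g, map (b g) s = t.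
Proof.
move=> infX ktr us ut st sk; have [x0 _] := infX [::].
have [s' us' s'k] := uniq_extend (k - size s) infX us.
have [t' ut' t'k] := uniq_extend (k - size s) infX ut.
have nth_inj w : uniq w -> size w = k ->
    injective (fun i : 'I_k => nth x0 w i).
  move=> uw wk i j /eqP; rewrite nth_uniq ?wk ?ltn_ord // => /eqP.
  exact: val_inj.
have ks : size (s ++ s') = k by rewrite size_cat s'k subnKC.
have kt : size (t ++ t') = k by rewrite size_cat t'k -st subnKC.
have [g gst] := ktr _ _ (nth_inj _ us' ks) (nth_inj _ ut' kt).
exists g; apply: (@eq_from_nth _ x0); rewrite size_map // => i si.
have := gst (Ordinal (leq_trans si sk)); rewrite /= !nth_cat -st si.
by rewrite (nth_map x0).
Qed.

Hypothesis tr4 : forall s t : seq X, uniq s -> uniq t -> size s = size t ->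
  (size s <= 4)%N -> exists g, map (b g) s = t.

(* A pair is in one of seven positions relative to another one; each position is
   realized by some [k] at the fixed pair [(w1, w2)]. *)
Lemma pair_double_cosets (w1 w2 : X) :
  (forall s : seq X, exists x, x \notin s) -> w1 != w2 ->
  exists ks : seq G, forall v1 v2 v3 v4 : X, v1 != v2 -> v3 != v4 ->
    exists2 k, k \in ks & exists g,
      [/\ b g w1 = v1, b g w2 = v2, b (g * k)%g w1 = v3 & b (g * k)%g w2 = v4].
Proof.
move=> infX w12.
have uw : uniq [:: w1; w2] by rewrite /= inE w12.
have [[|w3 [|w4 [|]]] //= uws _] := uniq_extend 2 infX uw.
move: uws; rewrite !inE !negb_or -!andbA => /and4P[_ w13 w14].
move=> /and4P[w23 w24 w34 _].
have ex2 z1 z2 : z1 != z2 -> exists k, b k w1 = z1 /\ b k w2 = z2.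
  move=> z12; have [||//|//|k /= [kz1 kz2]] := @tr4 [:: w1; w2] [:: z1; z2].
  - by rewrite /= inE w12.
  - by rewrite /= inE z12.
  - by exists k.
have [k21 [k211 k212]] : exists k, b k w1 = w2 /\ b k w2 = w1.
  by apply: ex2; rewrite eq_sym.
have [k13 [k131 k132]] := ex2 _ _ w13.
have [k31 [k311 k312]] : exists k, b k w1 = w3 /\ b k w2 = w1.
  by apply: ex2; rewrite eq_sym.
have [k23 [k231 k232]] := ex2 _ _ w23.
have [k32 [k321 k322]] : exists k, b k w1 = w3 /\ b k w2 = w2.
  by apply: ex2; rewrite eq_sym.
have [k34 [k341 k342]] := ex2 _ _ w34.
exists [:: 1%g; k21; k13; k31; k23; k32; k34] => v1 v2 v3 v4 v12 v34.
have ex3 z : v1 != z -> v2 != z ->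
    exists g, [/\ b g w1 = v1, b g w2 = v2 & b g w3 = z].
  move=> v1z v2z.
  have [||//|//|g /= [g1 g2 g3]] := @tr4 [:: w1; w2; w3] [:: v1; v2; z].
  - by rewrite /= !inE negb_or w12 w13 w23.
  - by rewrite /= !inE negb_or v12 v1z v2z.
  - by exists g.
have ex12 : exists g, b g w1 = v1 /\ b g w2 = v2 by exact: ex2.
have [v13|v13] := eqVneq v1 v3; have [v24|v24] := eqVneq v2 v4.
- exists 1%g; rewrite ?inE ?eqxx //; have [g [g1 g2]] := ex12.
  by exists g; rewrite mulg1 -v13 -v24.
- have [g [g1 g2 g3]] : exists g, [/\ b g w1 = v1, b g w2 = v2 & b g w3 = v4].
    by apply: ex3; rewrite // v13.
  exists k13; first by rewrite !inE eqxx !orbT.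
  by exists g; rewrite !gactM k131 k132 -v13.
- have [g [g1 g2 g3]] : exists g, [/\ b g w1 = v1, b g w2 = v2 & b g w3 = v3].
    by apply: ex3; rewrite // v24 eq_sym.
  exists k32; first by rewrite !inE eqxx !orbT.
  by exists g; rewrite !gactM k321 k322 -v24.
have [v14|v14] := eqVneq v1 v4; have [v23|v23] := eqVneq v2 v3.
- exists k21; first by rewrite !inE eqxx !orbT.
  by have [g [g1 g2]] := ex12; exists g; rewrite !gactM k211 k212 -v23 -v14.
- have [g [g1 g2 g3]] := ex3 _ v13 v23.
  exists k31; first by rewrite !inE eqxx !orbT.
  by exists g; rewrite !gactM k311 k312 -v14.
- have [g [g1 g2 g3]] := ex3 _ v14 v24.
  exists k23; first by rewrite !inE eqxx !orbT.
  by exists g; rewrite !gactM k231 k232 -v23.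
have [||//|//|g /= [g1 g2 g3 g4]] :=
    @tr4 [:: w1; w2; w3; w4] [:: v1; v2; v3; v4].
- by rewrite /= !inE !negb_or w12 w13 w14 w23 w24 w34.
- by rewrite /= !inE !negb_or v12 v13 v14 v23 v24 v34.
- exists k34; first by rewrite !inE eqxx !orbT.
  by exists g; rewrite !gactM k341 k342.
Qed.

End transitivity.

(** If [Q] agrees on [c] and [c'], take [z] with the other value of [Q]; it differs in [P] from one
    of [c], [c']. *)
Lemma separating_pair (X : Type) (P Q : pred X) (c c' e e' : X) :
  P c -> ~~ P c' -> Q e -> ~~ Q e' ->
  exists x y, P x != P y /\ Q x != Q y.
Proof.
move=> Pc /negbTE Pc' Qe /negbTE Qe'.
have [Qcc|Qcc] := eqVneq (Q c) (Q c'); last by exists c, c'; rewrite Pc Pc'.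
have [z zQ] : exists z, Q z != Q c.
  by case: (boolP (Q c)) => Qc; [exists e'|exists e]; rewrite ?Qe ?Qe'.
case: (boolP (P z)) => Pz; [exists z, c'|exists z, c]; split=> //.
- by rewrite Pz Pc'.
- by rewrite -Qcc.
- by rewrite (negbTE Pz) Pc.
Qed.

(** * 4-transitive actions of a group of general type *)

Section transitive_actions.
Context {R : realType} {G : groupType} {S : metricType R} (a : isoaction G S).
Context (o : S) (d : R).
Hypothesis hyp : forall x y z : S,
  Num.min (gromov x z o) (gromov z y o) - d <= gromov x y o.
Hypothesis gta : general_type a.
Hypothesis fa : faithful (limit_action a).
Context {X : choiceType} (b : gaction G X).
Hypothesis fb : faithful b.
Hypothesis infX : forall s : seq X, exists x, x \notin s.
Hypothesis tr4 : forall s t : seq X, uniq s -> uniq t -> size s = size t ->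
  (size s <= 4)%N -> exists g, map (b g) s = t.

Lemma moved_point (f : G) : f <> 1%g ->
  exists2 p, limit_set a p & bact a f p <> p.
Proof.
move=> f1; apply: contrapT => nex; apply: f1; apply: (faithful_bact fa) => p lp.
by rewrite bact1; apply: contrapT => fp; apply: nex; exists p.
Qed.

Lemma conj_neq1 (f t : G) : f <> 1%g -> (t * f * t^-1)%g <> 1%g.
Proof.
by move=> f1 /divg1_eq tf; apply: f1; apply: (mulgI t); rewrite tf mulg1.
Qed.

Lemma supp_in_fix_near f y y' r s E q :
  supp_in a o f y' r -> gromov y y' o <= E -> E + 4 * d < s -> s <= r ->
  shadow o y r q ->
  forall p, limit_set a p -> near_bdry o q p s -> bact a f p = p.
Proof.
move=> fy' yE Es sr yq p lp qp; apply: contrapT => fp.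
have d0 := four_point_ge0 hyp.
have shle z K K' t : K' <= K -> shadow o z K t -> shadow o z K' t.
  by move=> KK [u tu uz]; exists u => //; exact: prod_ge_le uz.
have y'p := shle _ _ (s - d - d) _ _ (fy' p lp fp).
have yp := near_shadow hyp (near_bdryC qp) (shle _ _ s _ sr yq).
by apply: (shadow_disjoint hyp yE _ yp (y'p _)); lra.
Qed.

Lemma near_bdry_act g p q r : near_bdry o p q r ->
  near_bdry o (bact a g p) (bact a g q) (r - mdist (a g o) o).
Proof.
move=> [u [v [pu qv [N uvN]]]]; exists (a g \o u), (a g \o v).
split; [exact: bclass_act|exact: bclass_act|exists N => i j Ni Nj /=].
have := gromov_le_base (a g (u i)) (a g (v j)) (a g o) o.
by rewrite gromov_act; have := uvN i j Ni Nj; lra.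
Qed.

(* Otherwise [h f1 h^-1] moves a point near [q]; the points close to it are
   fixed by [h f2 h^-1], whose support is disjoint from that of [h f1 h^-1]. *)
Lemma commutator_small f1 f2 h y1 y2 r E q :
  supp_in a o f1 y1 r -> supp_in a o f2 y2 r ->
  gromov y1 y2 o <= E -> E + 4 * d < r ->
  limit_set a q ->
  (forall p, limit_set a p -> near_bdry o q p (r - d - d) -> bact a f1 p = p) ->
  (forall p, limit_set a p -> near_bdry o q p (r - d - d) -> bact a f2 p = p) ->
  small a o (h * f1 * h^-1 * f1^-1)%g \/ small a o (h * f2 * h^-1 * f2^-1)%g.
Proof.
move=> s1 s2 y12 Er lq fix1 fix2; have d0 := four_point_ge0 hyp.
have [all1|] := pselect (forall p, limit_set a p -> near_bdry o q p r ->
    bact a (h * f1 * h^-1)%g p = p).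
  left; exists q, r; split => // p lp qp.
  rewrite bactM bact_fixV ?all1 //; apply: fix1 => //.
  by apply: near_bdry_le qp; lra.
move=> /existsNP[p /not_implyP[lp /not_implyP[qp /conj_moved hp]]].
have lhp := limit_set_act h^-1%g lp.
have y1p := s1 _ lhp hp.
right; exists p, (r + mdist (a h^-1%g o) o); split => // p' lp' pp'.
have D0 := mdist_ge0 (a h^-1%g o) o.
have pp'r : near_bdry o p p' r by apply: near_bdry_le pp'; lra.
have qp' := near_bdry_trans hyp qp pp'r.
rewrite bactM (bact_fixV (fix2 _ lp' qp')) !bactM.
rewrite (supp_in_fix_near s2 y12 Er (lexx _) y1p) ?bactKV //.
  exact: limit_set_act.
by have := near_bdry_act h^-1%g pp'; rewrite addrK.
Qed.

Lemma free_case f : f <> 1%g -> small a o f ->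
  (forall g, g <> 1%g -> small a o g -> forall x, b g x != x) -> False.
Proof.
move=> f_neq1 fs free; have d0 := four_point_ge0 hyp.
have [E /(_ f) spread] := small_conj_spread hyp gta.
have := spread (E + 6 * d + 1) fs.
move=> [t1 [t2 [t3 [y1 [y2 [y3 [[y12 y13 y23] [s1 s2 s3]]]]]]]].
move: s1 s2 s3 (conj_neq1 (t := t1) f_neq1) (conj_neq1 (t := t2) f_neq1)
  (conj_neq1 (t := t3) f_neq1).
set f1 := (t1 * f * _)%g; set f2 := (t2 * f * _)%g; set f3 := (t3 * f * _)%g.
clearbody f1 f2 f3.
set r := E + 6 * d + 1 => s1 s2 s3 f1_neq1 f2_neq1 f3_neq1.
have [q1 lq1 q1m] := moved_point f1_neq1.
(* Near [q3] both [f1] and [f2] are trivial, so all words in them are small. *)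
have [q3 lq3 q3m] := moved_point f3_neq1.
have y3q := s3 _ lq3 q3m.
have fix1 p : limit_set a p -> near_bdry o q3 p (r - d - d) -> bact a f1 p = p.
  by apply: (supp_in_fix_near s1 _ _ _ y3q); rewrite 1?gromovC; try exact: y13;
    rewrite /r; lra.
have fix2 p : limit_set a p -> near_bdry o q3 p (r - d - d) -> bact a f2 p = p.
  by apply: (supp_in_fix_near s2 _ _ _ y3q); rewrite 1?gromovC; try exact: y23;
    rewrite /r; lra.
have disj p : limit_set a p -> bact a f1 p = p \/ bact a f2 p = p.
  move=> lp; have [|f1p] := pselect (bact a f1 p = p); first by left.
  right; apply: contrapT => f2p.
  apply: (shadow_disjoint hyp y12 _ (s1 _ lp f1p) (s2 _ lp f2p)).
  by rewrite /r; lra.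
have f12 := disjoint_supp_commute fa disj.
have f2q1 : bact a f2 q1 = q1 by case: (disj q1 lq1).
have fix_small g : (forall p, limit_set a p -> bact a f1 p = p ->
    bact a f2 p = p -> bact a g p = p) -> small a o g.
  by move=> gfix; exists q3, (r - d - d); split => // p lp qp; auto.
have [x0 _] := infX [::].
have f1x x : b f1 x != x by apply: free => //; apply: fix_small.
have f2x x : b f2 x != x by apply: free => //; apply: fix_small.
have f12x x : b (f1 * f2)%g x != x.
  apply: free; last by apply: fix_small => p lp p1 p2; rewrite bactM p2 p1.
  by move=> f12_1; apply: q1m; rewrite -{1}f2q1 -bactM f12_1 bact1.
have f1Vx x : b f1 x != b f2 x.
  apply/eqP => f12E; have /eqP : b (f1^-1 * f2)%g x = x.
    by rewrite gactM -f12E gactK.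
  apply/negP; apply: free; last first.
    by apply: fix_small => p lp p1 p2; rewrite bactM p2 bact_fixV.
  move=> /(congr1 (fun g => f1 * g)%g); rewrite mulVKg mulg1 => f2E.
  by apply: q1m; rewrite -f2E.
have f1_12 : b f1 x0 != b (f1 * f2)%g x0.
  by rewrite gactM (can_eq (gactK b f1)) eq_sym (f2x x0).
have f2_12 : b f2 x0 != b (f1 * f2)%g x0.
  by rewrite gactM eq_sym (f1x (b f2 x0)).
have pts : uniq [:: x0; b f1 x0; b f2 x0; b (f1 * f2)%g x0].
  rewrite /= !inE !negb_or !(eq_sym x0) (f1x x0) (f2x x0) (f12x x0) (f1Vx x0).
  by rewrite f1_12 f2_12.
(* A fifth point, to which [h] will send [f1 f2 x0] while fixing the other three. *)
have [z] := infX [:: x0; b f1 x0; b f2 x0; b (f1 * f2)%g x0].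
rewrite !inE !negb_or => /and4P[z0 z1 z2 z12].
have [|//|//|h /= [h0 h1 h2 h12]] := @tr4 _ [:: x0; b f1 x0; b f2 x0; z] pts.
  by rewrite /= !inE !negb_or !(eq_sym x0) (eq_sym _ z) (eq_sym _ z) z0 z1 z2
    (f1x x0) (f2x x0) (f1Vx x0).
have hV0 : b h^-1%g x0 = x0 by rewrite -{1}h0 gactK.
have comm g : b h (b g x0) = b g x0 -> small a o (h * g * h^-1 * g^-1)%g ->
    (h * g = g * h)%g.
  move=> hg sg; have : (h * g * h^-1 * g^-1)%g = 1%g.
    apply: contrapT => /free /(_ sg (b g x0)) /eqP; apply.
    by rewrite !gactM gactK hV0 hg.
  by move=> /divg1_eq hgE; rewrite -[in RHS]hgE mulgVK.
move: z12 => /eqP; apply; rewrite -h12.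
have r_gt : E + 4 * d < r by rewrite /r; lra.
have [/(comm _ h1) hf|/(comm _ h2) hf] :=
  commutator_small h s1 s2 y12 r_gt lq3 fix1 fix2.
  by rewrite -gactM mulgA hf !gactM h2.
by rewrite -gactM f12 mulgA hf !gactM h1.
Qed.

(** Otherwise [g f g^-1] commutes with [l], so it fixes both or neither of [v] and [l v], that is,
    of [g w1] and [g w2]. *)
Lemma supports_meet (f l g : G) (w1 w2 v : X) :
  (b f w1 == w1) != (b f w2 == w2) -> b g w1 = v -> b g w2 = b l v ->
  exists p, [/\ limit_set a p, bact a f p <> p &
    bact a l (bact a g p) <> bact a g p].
Proof.
move=> f12 g1 g2; apply: contrapT => nex; move: f12 => /negP; apply.
have comm : (g * f * g^-1 * l = l * (g * f * g^-1))%g.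
  apply: (disjoint_supp_commute fa) => p lp.
  have [|/conj_moved fp] := pselect (bact a (g * f * g^-1)%g p = p).
    by left.
  right; apply: contrapT => lp'; apply: nex; exists (bact a g^-1%g p).
  by split => //; [exact: limit_set_act|rewrite bactKV].
rewrite -(can_eq (gactK b g) (b f w2)) -(can_eq (gactK b g) (b f w1)).
have gf x : b g (b f x) = b (g * f * g^-1)%g (b g x).
  by rewrite !gactM gactK.
have lf : b (g * f * g^-1)%g (b l v) = b l (b (g * f * g^-1)%g v).
  by rewrite -(gactM b _ l) comm (gactM b l).
by rewrite !gf g1 g2 lf (can_eq (gactK b l)).
Qed.

Lemma nonfree_case f x0 : f <> 1%g -> small a o f -> b f x0 = x0 -> False.
Proof.
move=> f_neq1 fs fx0; have d0 := four_point_ge0 hyp.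
have [x1 fx1] : exists x1, b f x1 <> x1.
  by apply/existsNP => ffix; apply/f_neq1/fb.
have [E /(_ f) spread] := small_conj_spread hyp gta.
have := spread (E + 2 * d + 1) fs.
move=> [t1 [t2 [_ [y1 [y2 [_ [[y12 _ _] [s1 s2 _]]]]]]]].
have conj_fix t : b (t * f * t^-1)%g (b t x0) == b t x0.
  by rewrite !gactM gactK fx0.
have conj_mov t : b (t * f * t^-1)%g (b t x1) != b t x1.
  by rewrite !gactM gactK (can_eq (gactK b t)); apply/eqP.
have [w1 [w2 [w12f1 w12f2]]] := separating_pair
  (P := fun x => b (t1 * f * t1^-1)%g x == x)
  (Q := fun x => b (t2 * f * t2^-1)%g x == x)
  (conj_fix t1) (conj_mov t1) (conj_fix t2) (conj_mov t2).
have w12 : w1 != w2 by apply: contraNneq w12f1 => ->.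
have [ks kP] := pair_double_cosets tr4 infX w12.
(* [C] bounds the displacement of [o] by every [k] in [ks], and is settled before the depth [r]. *)
pose C := \sum_(k <- ks) mdist (a k o) o.
have kC k : k \in ks -> mdist (a k o) o <= C.
  move=> kks; rewrite /C (big_rem k) //= lerDl sumr_ge0 // => *.
  exact: mdist_ge0.
(* Each of [g o] and [g k o] loses [E + 5 * d], their distance loses [C], and joining [z1] to [z2]
   loses [2 * d]; what remains is [E + 1]. *)
have := spread (2 * E + 7 * d + C + 1) fs; set r := 2 * E + _ + _ + _.
move=> [u1 [u2 [_ [z1 [z2 [_ [[z12 _ _] [l1 l2 _]]]]]]]].
move: (conj_mov u1) (conj_mov u2); set v1 := b u1 x1; set v3 := b u2 x1.
rewrite eq_sym => lv1; rewrite eq_sym => lv3.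
have [k kks [g [g1 g2 g3 g4]]] := kP _ _ _ _ lv1 lv3.
have dir h l v z : supp_in a o l z r -> b h w1 = v -> b h w2 = b l v ->
    r - E - 5 * d <= gromov (a h o) z o.
  move=> ls h1 h2; have [p [lp fp hp]] := supports_meet w12f1 h1 h2.
  have [q [lq fq hq]] := supports_meet w12f2 h1 h2.
  apply: (gromov_of_two_points hyp y12 _ (s1 _ lp fp) (s2 _ lq fq)); first by lra.
    exact: ls (limit_set_act _ lp) hp.
  exact: ls (limit_set_act _ lq) hq.
have goz := dir _ _ _ _ l1 g1 g2; have gkoz := dir _ _ _ _ l2 g3 g4.
have gok : r - E - 5 * d - C <= gromov (a g o) (a (g * k)%g o) o.
  apply: le_trans (mdist_sub_le_gromov _ _ _).
  rewrite gactM iso_mdist (metric_sym o).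
  have := kC _ kks; have := gromov_le_mdist (a g o) z1 o; lra.
have C0 : 0 <= C by apply: sumr_ge0 => *; exact: mdist_ge0.
have zgo : r - E - 5 * d - C <= gromov z1 (a g o) o by rewrite gromovC; lra.
have gkz : r - E - 5 * d - C - d <= gromov (a (g * k)%g o) z2 o by lra.
have := gromov_trans hyp (gromov_trans hyp zgo gok) gkz.
by rewrite /r; lra.
Qed.

End transitive_actions.

(** * Excluding actions on finite sets *)

Section finite_actions.
Context {R : realType} {G : groupType} {S : metricType R} (a : isoaction G S).
Context {X : choiceType} (b : gaction G X).

(** Faithfulness embeds the group into the self-maps of a finite set, so only finitely many
    displacements of [o] occur. *)
Lemma finite_faithful_bounded_orbits (o : S) (s : seq X) :
  faithful b -> (forall x, x \in s) ->
  ~ unbounded_orbits a setT.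
Proof.
move=> fb sX unb.
pose perm g := [ffun x : seq_sub s => SeqSub (sX (b g (ssval x)))].
have perm_inj : injective perm.
  move=> g h gh; apply: divg1_eq; apply: fb => x.
  have /(congr1 (fun F : {ffun seq_sub s -> seq_sub s} =>
    ssval (F (SeqSub (sX (b h^-1%g x)))))) := gh.
  by rewrite !ffunE /= gactM => ->; rewrite gactKV.
(* Self-maps not induced by the group get the harmless value [0]. *)
pose D (t : {ffun seq_sub s -> seq_sub s}) : R :=
  if pselect (exists g, perm g = t) is left ex
  then mdist (a (projT1 (cid ex)) o) o else 0.
have D0 t : 0 <= D t by rewrite /D; case: pselect => // ex; exact: mdist_ge0.
have DE g : D (perm g) = mdist (a g o) o.
  rewrite /D; case: pselect => [ex|]; last by case; exists g.
  by case: cid => h /= /perm_inj ->.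
have bound g : mdist (a g o) o <= \sum_t D t.
  by rewrite -DE (bigD1 (perm g)) //= lerDl sumr_ge0.
apply: (unb o); exists (\sum_t D t + \sum_t D t) => g h _ _.
by apply: le_trans (metric_triangle _ o _) _; rewrite lerD // metric_sym.
Qed.

End finite_actions.

Theorem corollary1p10 (R : realType) (G : groupType)
    (Gfwh : faithful_weakly_hyperbolic R G) (Gnlf : ~ lim_free R G) :
  (transitivity_degree R G <= 3%:E)%E.
Proof.
have [S [a [[geoS [d d0 hyp]] gta fa]]] := Gfwh.
have [ o] : inhabited S.
  have [_ [_ [_ [[_ [p _]] _ _]]]] := gta.
  by have [u _] := bclass_nonempty p; exact: (inhabits (u 0%N)).
have hypo (x y z : S) := hyp x y z o.
have [f f1 fs] : exists2 f : G, f <> 1%g & small a o f.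
  apply: (not_topologically_free_small hypo) => tf.
  by apply: Gnlf; exists S, a; split => //; split => //; exists d.
apply: ge_ereal_sup => _ [k [X [b [fb ktr]]] <-].
rewrite lee_fin (ler_nat _ k 3) leqNgt; apply/negP => k4.
(* Classical choice equips the arbitrary type [X] with the decidable equality that [seq] membership
   requires. *)
pose Y : choiceType := {classic X}; pose c : gaction G Y := b.
have infX : forall s : seq Y, exists x, x \notin s.
  move=> s; apply: contrapT => /forallNP sX.
  apply: (@finite_faithful_bounded_orbits _ _ _ a _ c o s fb); last by case: gta.
  by move=> x; apply: contrapT => /negP; exact: sX.
have tr4 (s t : seq Y) : uniq s -> uniq t -> size s = size t ->
    (size s <= 4)%N -> exists g, map (c g) s = t.
  move=> us ut st s4; apply: (@ktransitive_seq _ _ c k) => //.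
  exact: leq_trans k4.
have [[g [g1 gs [x gx]]]|nfree] := pselect (exists g, [/\ g <> 1%g,
    small a o g & exists x, c g x = x]).
  exact: (nonfree_case (b := c) hypo gta fa fb infX tr4 g1 gs gx).
apply: (free_case hypo gta fa infX tr4 f1 fs) => g g1 gs x.
by apply/eqP => gx; apply: nfree; exists g; split => //; exists x.
Qed.
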